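(* Every downset $\mathcal{D}$ with $|U(\mathcal{D})| \leq 7$ has the star property; that is, Chvátal's conjecture holds for all downsets $\mathcal{D}$ such that $|U(\mathcal{D})|\le 7$.
   Context: A family is a set of subsets of a finite ground set; $U(\mathcal{F})$ denotes the union of all sets in the family $\mathcal{F}$. A family $\mathcal{D}$ is a downset if $A \in \mathcal{D}$ and $B \subseteq A$ imply $B \in \mathcal{D}$. A family is intersecting if any two of its sets have nonempty intersection. A family is a star if there is an element of $U(\mathcal{F})$ contained in all sets of $\mathcal{F}$. A family $\mathcal{F}$ has the star property if some maximum-cardinality intersecting family contained in $\mathcal{F}$ is a star. Chvátal's conjecture asserts that every downset has the star property.
   Formalization: The downset is assumed to have nonempty union; this excludes only the empty family and the family {∅}, for which no subfamily has an element in its union, so no star exists and the claim read literally fails. *)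

(* Defs.v *)
From mathcomp Require Import all_boot.

Set Implicit Arguments.
Unset Strict Implicit.
Unset Printing Implicit Defensive.

(* A family on a finite ground set T is a term of type {set {set T}}, and its
   union U(F) is cover F.  U(F) may be a proper subset of T. *)

Definition downset (T : finType) (D : {set {set T}}) : Prop :=
  forall A B : {set T}, A \in D -> B \subset A -> B \in D.

(* The two sets may coincide, so an intersecting family never contains set0. *)
Definition intersecting (T : finType) (F : {set {set T}}) : Prop :=
  forall A B : {set T}, A \in F -> B \in F -> A :&: B != set0.

(* As x ranges over cover F, the empty family is not a star. *)
Definition star (T : finType) (F : {set {set T}}) : Prop :=
  exists2 x : T, x \in cover F & forall A : {set T}, A \in F -> x \in A.

Definition max_intersecting_in (T : finType) (D F : {set {set T}}) : Prop :=
  [/\ F \subset D, intersecting F &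
      forall G : {set {set T}},
        G \subset D -> intersecting G -> #|G| <= #|F|].

(* For the degenerate downsets set0 and [set set0], whose union is empty, the
   only intersecting subfamily is set0, and the property fails. *)
Definition star_property (T : finType) (D : {set {set T}}) : Prop :=
  exists2 F : {set {set T}}, max_intersecting_in D F & star F.

(* Main.v *)
From Stdlib Require Import BinPos.
Require Import Defs.
From mathcomp Require Import all_boot.
From mathcomp Require Import zify.

(* Every intersecting family on 7 points is contained in one that is closed upwards and contains
   exactly one set of each complementary pair; let F be such a family. In the spirit of a
   conjecture of Kleitman, F is dominated by stars: there are weights w_x with sum N > 0 such that
   N |F :&: D| <= \sum_x w_x |{A in D | x in A}| for every downset D, whence |F :&: D| is at most
   the size of some star of D. To prove the inequality, give each A in F the mass N and each A the
   capacity w(A) = \sum_(x in A) w_x, and ship the mass of each A to subsets of A within capacity;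
   a downset containing A then contains all the targets.
   There are 716 such families F up to relabelling the points. A search decides, for one set of size
   at most 3 after another, whether it belongs to F. A branch is cut when a relabelling of the
   points makes the membership vector of F lexicographically larger (induction on that vector), and each
   surviving leaf carries weights and a shipping plan. *)

Set Implicit Arguments.
Unset Strict Implicit.
Unset Printing Implicit Defensive.

(** * The search procedure *)

(* The subset of {0, ..., n-1} with characteristic vector [p] of length n. *)
Notation point_set := (seq bool).

(** [all2] fails on sequences of different lengths, so only subsets of the same ground set are
    related. *)
Definition below (p q : point_set) : bool := all2 implb p q.

Fixpoint subs (p : point_set) : seq point_set :=
  if p is b :: p' then
    let r := subs p' in (if b then map (cons true) r else [::]) ++ map (cons false) r
  else [:: [::]].

Definition cube (n : nat) : seq point_set := subs (nseq n true).

(** A complete binary tree with one leaf per subset, the left branch being for sets that contain the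
    current point. Reading and updating take [n] steps, which matters when the search is
    evaluated. *)
Fixpoint trie (X : Type) (n : nat) : Type :=
  if n is m.+1 then (trie X m * trie X m)%type else X.

Fixpoint get X n : trie X n -> point_set -> X :=
  match n with
  | 0 => fun t _ => t
  | m.+1 => fun t p => if head false p then get t.1 (behead p) else get t.2 (behead p)
  end.

Fixpoint upd X n : trie X n -> point_set -> X -> trie X n :=
  match n with
  | 0 => fun _ _ x => x
  | m.+1 => fun t p x => if head false p then (upd t.1 (behead p) x, t.2)
                         else (t.1, upd t.2 (behead p) x)
  end.

Fixpoint tabulate X n : (point_set -> X) -> trie X n :=
  match n with
  | 0 => fun f => f [::]
  | m.+1 => fun f => (tabulate m (fun p => f (true :: p)), tabulate m (fun p => f (false :: p)))
  end.

(* Bits are read from the least significant end; [k] is what has been read of the current number. *)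
Fixpoint read_unary (n k : nat) (c : positive) {struct c} : seq nat * positive :=
  if n is m.+1 then
    match c with
    | xI c' => read_unary n k.+1 c'
    | xO c' => let: (l, c'') := read_unary m 0 c' in (k :: l, c'')
    | xH => ([::], xH)
    end
  else ([::], c).

Fixpoint weight (p : point_set) (w : seq nat) : nat :=
  match p, w with
  | b :: p', k :: w' => if b then k + weight p' w' else weight p' w'
  | _, _ => 0
  end.

(* Each set of [qs] with room left consumes one bit of [c], which tells whether to ship to it as
   much as possible or nothing. *)
Fixpoint ship n (x : nat) (qs : seq point_set) (r : trie nat n) (c : positive) :
    option (trie nat n * positive) :=
  match x with
  | 0 => Some (r, c)
  | _.+1 =>
    match qs with
    | [::] => None
    | q :: qs' =>
      match get r q with
      | 0 => ship x qs' r c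
      | y.+1 =>
        match c with
        | xI c' => ship (x - y.+1) qs' (upd r q (y.+1 - x)) c'
        | xO c' => ship x qs' r c'
        | xH => None
        end
      end
    end
  end.

Fixpoint transport n (surplus : point_set -> nat) (ps : seq point_set) (r : trie nat n)
    (c : positive) : bool :=
  if ps is p :: ps' then
    if ship (surplus p) (subs p) r c is Some (r', c') then transport surplus ps' r' c' else false
  else true.

Definition load n (t : trie (option bool) n) (N : nat) (p : point_set) : nat :=
  if get t p is Some true then N else 0.

(** The mass and the capacity of each set are cancelled against each other first, so only the
    truncated differences are shipped. Reversing the cube handles every set after its proper
    subsets. Testing that every set has a value replaces a proof that the decided sets and their
    complements exhaust the cube. *)
Definition majorized n (t : trie (option bool) n) (c : positive) : bool :=
  let: (w, c') := read_unary n 0 c in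
  [&& 0 < sumn w, all (fun p => if get t p is Some _ then true else false) (cube n)
    & transport (fun p => load t (sumn w) p - weight p w) (rev (cube n))
        (tabulate n (fun p => weight p w - load t (sumn w) p)) c'].

Definition permute (s : seq nat) (p : point_set) : point_set := [seq nth false p k | k <- s].

(* Whether the known values already make the membership vector of F along [vs] smaller than that of
   the relabelled family [fun p => F (permute s p)]. *)
Fixpoint improves n (t : trie (option bool) n) (s : seq nat) (vs : seq point_set) : bool :=
  if vs is v :: vs' then
    match get t v, get t (permute s v) with
    | Some true, Some true | Some false, Some false => improves t s vs'
    | Some false, Some true => true
    | _, _ => false
    end
  else false.

Definition decide n (t : trie (option bool) n) (v : point_set) (b : bool) :=
  upd (upd t v (Some b)) (map negb v) (Some (~~ b)).

(** Disjointness is phrased as inclusion in the complement, the form to which upward closure and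
    duality apply directly. *)
Definition meets (p q : point_set) : bool := ~~ below q (map negb p).

(** For [n = 7] these 63 sets, their complements, the full set and the empty set make up the whole
    cube. Small sets come first, so that early members force many later sets into the family. *)
Definition undecided_sets (n : nat) : seq point_set :=
  [seq p <- cube n | count id p == 1] ++
  [seq p <- cube n | count id p == 2] ++ [seq p <- cube n | count id p == 3].

(* The relabellings [ss] and the certificates [cs] are consumed in depth-first order; what is left
   of them is returned. *)
Fixpoint search n (all_vs vs : seq point_set) (t : trie (option bool) n) (members : seq point_set)
    (ss : seq (seq nat)) (cs : seq positive) : option (seq (seq nat) * seq positive) :=
  if (if ss is s :: _ then improves t s all_vs && perm_eq s (iota 0 n) else false) then
    Some (behead ss, cs)
  else
    match vs with
    | [::] => if cs is c :: cs' then if majorized t c then Some (ss, cs') else None else None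
    | v :: vs' =>
      let rest := if all (meets v) members
                  then search all_vs vs' (decide t v true) (v :: members) ss cs
                  else Some (ss, cs) in
      if rest is Some (ss', cs') then
        if has (below^~ v) members then rest
        else search all_vs vs' (decide t v false) members ss' cs'
      else None
    end.

Definition initial_trie n : trie (option bool) n :=
  decide (tabulate n (fun=> None)) (nseq n true) true.

(** * Certificates *)

(* Found by computer. Each number holds 7 numbers in unary, in the format of [read_unary]: a
   permutation of the points here, the weights of the points in [weightings], where the bits of the
   shipping plan follow. *)
Definition relabellings : seq positive := [::
0x17efbdd9; 0x17efbdd6; 0x17efbdba; 0x17efbbda; 0x17ef7dda; 0x17dfbdda; 0x17dfbdda; 0x17ef7dda;
0x17dfbdda; 0x17ef7dda; 0x17dfbdda; 0x17ef7dda; 0x17efbbda; 0x17ef7dda; 0x17dfbdda; 0x17ef7dda;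
0x17dfbdda; 0x17ef7dda; 0x17efbbda; 0x17ef7dda; 0x17ef7dda; 0x17dfbdda; 0x17efbbda; 0x17dfbdda;
0x17efbbda; 0x17ef7dda; 0x17dfbdda; 0x17efbbda; 0x17dfbdda; 0x17ef7dda; 0x17dfbdda; 0x17ef7dda;
0x17dfbdda; 0x17efbbda; 0x17ef7dda; 0x17dfbdda; 0x17efbdba; 0x17efbbda; 0x17ef7dda; 0x17dfbdda;
0x17efbdd9; 0x17efbdba; 0x17efbbda; 0x17ef7dda; 0x17dfbdda; 0x17ef7dda; 0x17dfbdda; 0x17ef7dda;
0x17efbbda; 0x17ef7dda; 0x17ef7dda; 0x17dfbdda; 0x17efbbda; 0x17dfbdda; 0x17efbbda; 0x17ef7dda;
0x17dfbdda; 0x17efbbda; 0x17dfbdda; 0x17ef7dda; 0x17dfbdda; 0x17ef7dda; 0x17dfbdda; 0x17efbbda;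
0x17ef7dda; 0x17dfbdda; 0x17efbdba; 0x17efbbda; 0x17ef7dda; 0x17ef7dda; 0x17efbbda; 0x17dfbdba;
0x17efbbda; 0x17efbbda; 0x17efbbda; 0x17ef7dda; 0x17efbbda; 0x17ef7dda; 0x17efbbda; 0x17efbbda;
0x17ef7dda; 0x17efbdd9; 0x17ef7dda; 0x17efbbda; 0x17ef7dda; 0x17dfbdda; 0x17efbdba; 0x17dfbdda;
0x17efbbda; 0x17dfbdda; 0x17efbdba; 0x17efbbda; 0x17efbdba; 0x17ef7dba; 0x17efbbda; 0x17ef7dba;
0x17ef7dba; 0x17ef7dba; 0x17ef7dba; 0x17ef7dba; 0x17dfbdda; 0x17efbbda; 0x17dfbdda; 0x17dfbdda;
0x17efbdd9; 0x17dfbdda; 0x17efbdd9; 0x17ef7dd9; 0x17ef7dd9; 0x17dfbdda; 0x17efbbda; 0x17bbf7d9;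
0x17dfbdda; 0x17ef7dda; 0x17dfbdda; 0x17efbdba; 0x17ef7dda; 0x17dfbdda; 0x17eedf7a; 0x17ef7dda;
0x17efbbd9; 0x17efbbd9; 0x17ef7dda; 0x17efbdba; 0x17ef7dda; 0x17dfbdda; 0x17ef7dda; 0x17efbdd9;
0x17ef7dda; 0x17dfbdda; 0x17efbdba; 0x17ef7dda; 0x17dfbdda; 0x17efbbd9; 0x17dfbdda; 0x17efbbd9;
0x17ef7dba; 0x17efbbd9; 0x17dfbdda; 0x17ef7dda; 0x17dfbdda; 0x17efbdba; 0x17ef7dda; 0x17dfbdda;
0x17efbbda; 0x17ef7dda; 0x17dfbdda; 0x17efbdba; 0x17ef7dda; 0x17dfbdda; 0x17efbbda; 0x17dfbdda;
0x17ef7dda; 0x17efbdd9; 0x17efbbda; 0x17ef7dda; 0x17dfbdda; 0x17efbdba; 0x17ef7dda; 0x17dfbdda;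
0x17efbbda; 0x17dfbdda; 0x17ef7dda; 0x17efbdd6; 0x17efbdba; 0x17efbbda; 0x17ef7dda; 0x17dfbdda;
0x17efbdd9; 0x17efbdba; 0x17efbbda; 0x17ef7dda; 0x17dfbdda; 0x17efbdd6; 0x17efbbda; 0x17ef7dda;
0x17dfbdda; 0x17efbdba; 0x17ef7dda; 0x17dfbdda; 0x17efbbda; 0x17dfbdda; 0x17ef7dda; 0x17ef7dda;
0x17dfbdda; 0x17ef7dda; 0x17efbbda; 0x17ef7dda; 0x17ef7dda; 0x17dfbdda; 0x17efbbda; 0x17dfbdda;
0x17efbbda; 0x17ef7dda; 0x17dfbdda; 0x17efbbda; 0x17dfbdda; 0x17ef7dda; 0x17dfbdda; 0x17ef7dda;
0x17dfbdda; 0x17efbbda; 0x17ef7dda; 0x17dfbdda; 0x17efbdba; 0x17efbbda; 0x17ef7dda; 0x17ef7dda;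
0x17efbbda; 0x17dfbdba; 0x17efbbda; 0x17efbbda; 0x17efbbda; 0x17ef7dda; 0x17efbbda; 0x17ef7dda;
0x17efbbda; 0x17efbbda; 0x17ef7dda; 0x17efbdd9; 0x17ef7dda; 0x17efbbda; 0x17ef7dda; 0x17dfbdda;
0x17efbdba; 0x17dfbdda; 0x17efbbda; 0x17dfbdda; 0x17efbdba; 0x17efbbda; 0x17efbdba; 0x17ef7dba;
0x17efbbda; 0x17ef7dba; 0x17ef7dba; 0x17ef7dba; 0x17ef7dba; 0x17ef7dba; 0x17dfbdda; 0x17efbbda;
0x17dfbdda; 0x17dfbdda; 0x17efbdd9; 0x17dfbdda; 0x17efbdd9; 0x17ef7dd9; 0x17ef7dd9; 0x17dfbdda;
0x17efbbda; 0x17bbf7d9; 0x17dfbdda; 0x17ef7dda; 0x17dfbdda; 0x17efbdba; 0x17ef7dda; 0x17dfbdda;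
0x17eedf7a; 0x17ef7dda; 0x17efbbd9; 0x17efbbd9; 0x17ef7dda; 0x17efbdba; 0x17ef7dda; 0x17dfbdda;
0x17ef7dda; 0x17efbdd9; 0x17ef7dda; 0x17dfbdda; 0x17efbdba; 0x17ef7dda; 0x17dfbdda; 0x17efbbd9;
0x17dfbdda; 0x17efbbd9; 0x17ef7dba; 0x17efbbd9; 0x17dfbdda; 0x17ef7dda; 0x17dfbdda; 0x17efbdba;
0x17ef7dda; 0x17dfbdda; 0x17efbbda; 0x17ef7dda; 0x17dfbdda; 0x17efbdba; 0x17ef7dda; 0x17dfbdda;
0x17efbbda; 0x17dfbdda; 0x17ef7dda; 0x17efbdd9; 0x17efbbda; 0x17ef7dda; 0x17dfbdda; 0x17efbdba;
0x17ef7dda; 0x17dfbdda; 0x17efbbda; 0x17dfbdda; 0x17ef7dda; 0x17efbdd6; 0x17efbdba; 0x17efbbda;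
0x17ef7dda; 0x17ef7dda; 0x17efbbda; 0x17efbbda; 0x17efbbda; 0x17efbbda; 0x17ef7dda; 0x17efbbda;
0x17ef7dda; 0x17efbbda; 0x17efbbda; 0x17ef7dda; 0x17efbdd9; 0x17ef7dda; 0x17efbbda; 0x17ef7dda;
0x17efbdba; 0x17dfbdd6; 0x17efbbda; 0x17efbbda; 0x17efbbda; 0x17ef7dba; 0x17dfbdd6; 0x17ef7dba;
0x17efbbda; 0x17dfbdd6; 0x17efbbda; 0x17efbbda; 0x17dfbdd6; 0x17efbdd9; 0x17dfbdd6; 0x17dfbdd6;
0x17efbbda; 0x17dfbdd6; 0x17efbdba; 0x17efbdba; 0x17efbbda; 0x17efbbda; 0x17efbdba; 0x17efbbda;
0x17efbdba; 0x17ef7dba; 0x17efbbda; 0x17ef7dba; 0x17ef7dba; 0x17ef7dba; 0x17ef7dba; 0x17ef7dba;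
0x17efbbda; 0x17efbbda; 0x17efbbda; 0x17efbdd9; 0x17efbdd9; 0x17efbdd9; 0x17ef7dd9; 0x17ef7dd9;
0x17efbdb9; 0x17efbbda; 0x17ef7dda; 0x17efbdba; 0x17ef7dda; 0x17ef7dda; 0x17efbdba; 0x17efbdba;
0x17ef7dda; 0x17efbdba; 0x17efbdba; 0x17eedf7a; 0x17ef7dda; 0x17efbbd9; 0x17ef7dda; 0x17ef7dda;
0x17efbdd9; 0x17ef7dda; 0x17efbdd9; 0x17efbbd9; 0x17efbbd9; 0x17ef7dda; 0x17efbdba; 0x17ef7dda;
0x17efbdba; 0x17eedf7a; 0x17ef7dda; 0x17efbbd9; 0x17efbbd9; 0x17ef7dda; 0x17efbdba; 0x17ef7dda;
0x17efbdba; 0x17efbbd9; 0x17efbbd9; 0x17efbdba; 0x17efbdba; 0x17efbdba; 0x17ef7dda; 0x17efbdd9;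
0x17ef7dda; 0x17efbdd9; 0x17efbdba; 0x17ef7dda; 0x17efbdba; 0x17efbbd9; 0x17efbbd9; 0x17efbbd9;
0x17ef7dba; 0x17efbbd9; 0x17efbbd9; 0x17ef7dda; 0x17efbdba; 0x17ef7dda; 0x17efbdba; 0x17ef7dda;
0x17efbdba; 0x17efbbda; 0x17ef7dda; 0x17efbdba; 0x17ef7dda; 0x17efbbda; 0x17ef7dda; 0x17efbbda;
0x17ef7dda; 0x17efbdba; 0x17efbbda; 0x17ef7dda; 0x17efbdd9; 0x17efbbda; 0x17efbdba; 0x17efbbda;
0x17ef7dda; 0x17efbdd9; 0x17efbdd9; 0x17ef7dda; 0x17efbbd9; 0x17ef7dda; 0x17efbdba; 0x17ef7dda;
0x17efbbda; 0x17efbbda; 0x17ef7dda; 0x17efbdd9; 0x17efbbda; 0x17ef7dda; 0x17efbdd9; 0x17efbbda;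
0x17ef7dda; 0x17efbdb9; 0x17ef7dda; 0x17efbbda; 0x17ef7dda; 0x17efbdba; 0x17ef7dda; 0x17efbdba;
0x17efbbda; 0x17efbbda; 0x17ef7dda; 0x17efbdd9; 0x17efbbda; 0x17ef7dda; 0x17efbdd9; 0x17efbdba;
0x17ef7dda; 0x17efbdba; 0x17efbbda; 0x17efbbda; 0x17ef7dda; 0x17dfbdda; 0x17efbdd6; 0x17dfbdda;
0x17efbdba; 0x17dfbdda; 0x17efbbda; 0x17dfbdda; 0x17efbdd6; 0x17efbdba; 0x17efbdd6; 0x17efbbda;
0x17efbdba; 0x17efbdd6; 0x17ef7d76; 0x17efbbda; 0x17efbdd6; 0x17efbdd6; 0x17efbdd6; 0x17efbdd6;
0x17efbdd6; 0x17efbdd6; 0x17efbdd6; 0x17dfbdda; 0x17efbbda; 0x17dfbdda; 0x17dfbdda; 0x17efbdd9;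
0x17dfbdda; 0x17efbdd9; 0x17efbdd6; 0x17ef7dd3; 0x17efbdb9; 0x17efbdd6; 0x17dfbdda; 0x17efbdd6;
0x17efbbda; 0x17efbdd6; 0x17efbdd6; 0x17dfbdda; 0x17efbdd6; 0x17ef7dd6; 0x17efbdba; 0x17ef7dd6;
0x17ef7dd6; 0x17ef7dd6; 0x17dfbdba; 0x17ef7dd6; 0x17ef7dd6; 0x17dfbdba; 0x17ef7dd6; 0x17ef7dd6;
0x17dfbdba; 0x17ef7dd6; 0x17ef7dd6; 0x17ef7dd6; 0x17ef7dd6; 0x17ef7dd6; 0x17ef7dd6; 0x17efbdd9;
0x17ef7dd6; 0x17dfbdd9; 0x17ef7dd6; 0x17ef7dd6; 0x17efbbd9; 0x17efbbd9; 0x17ef7dd6; 0x17dfbbd9;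
0x17ef7dd6; 0x17ef7dd6; 0x17ef7dd6; 0x17dfbdda; 0x17efbdba; 0x17efbdba; 0x17dfbdda; 0x17efbbd9;
0x17efbdba; 0x17efbdba; 0x17efbbd9; 0x17efbbd9; 0x17efbdba; 0x17efbdba; 0x17efbdba; 0x17dfbdda;
0x17dfbdda; 0x17efbdba; 0x17dfbdda; 0x17efbdba; 0x17dfbdda; 0x17efbdd9; 0x17efbdd9; 0x17dfbdda;
0x17efbdba; 0x17efbdba; 0x17dfbdda; 0x17efbbd9; 0x17dfbdda; 0x17efbbd9; 0x17efbbd9; 0x17efbbd9;
0x17dfbdda; 0x17efbdba; 0x17dfbdda; 0x17efbdba; 0x17efbdba; 0x17dfbdda; 0x17efbdba; 0x17efbdba;
0x17dfbdda; 0x17efbbda; 0x17efbdba; 0x17bbf7d6; 0x17bbf7d6; 0x17bbf7d6; 0x17bbf7d6; 0x17dfbdda;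
0x17bbf7d6; 0x17efbdd9; 0x17efbbda; 0x17bbf7d6; 0x17bbf7d6; 0x17bbf7d6; 0x17bbf7d6; 0x17bbf7d6;
0x17efbdd9; 0x17bbf7d6; 0x17bbf7d6; 0x17dfbdda; 0x17efbbda; 0x17dfbdda; 0x17bbf7d6; 0x17efbdd9;
0x17efbbda; 0x17bbf7d6; 0x17dfbdda; 0x17bbf7d6; 0x17efbdba; 0x17efbdba; 0x17efbbda; 0x17ebddbe;
0x17efbdd9; 0x17efbbda; 0x17efbdba; 0x17efbbda; 0x17afddbe; 0x17efbdd9; 0x17afddbe; 0x17afddbe;
0x17efbdba; 0x17afddbe; 0x17efbdd9; 0x17efbdd9; 0x17efbdd9; 0x17efbbd9; 0x17efbdba; 0x17efbbda;
0x17dfbdba; 0x17dfbdba; 0x17efbdd9; 0x17dfbdd9; 0x17dfbdba; 0x17efbbda; 0x17efbbda; 0x17efbdd9;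
0x17efbdd9; 0x17efbbda; 0x17dfbdd9; 0x17efbbda; 0x17efbdb9; 0x17efbbda; 0x17efbdd9; 0x17efbbda;
0x17efbdd9; 0x17efbdd9; 0x17efbbda; 0x17efbdd9; 0x17dfbdd9; 0x17efbbda; 0x17dfbdd9; 0x17efbdb9;
0x17efbdb9; 0x17efbbda; 0x17dfbdda; 0x17efbdba; 0x17efbdba; 0x17dfbdda; 0x17efbbda; 0x17dfbdda;
0x17efbdd9; 0x17dfbdda; 0x17efbdba; 0x17dfbdda; 0x17efbbda; 0x17dfbdda; 0x17efbdd9; 0x17efbbda;
0x17efbdd9; 0x17dfbdda; 0x17efbdba; 0x17efbdba; 0x17dfbdda; 0x17efbbda; 0x17dfbdda; 0x17efbdd9;
0x17ef7dda; 0x17dfbdda; 0x17efbdd6; 0x17ef7dda; 0x17dfbdda; 0x17efbdba; 0x17ef7dda; 0x17dfbdda;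
0x17efbdd6; 0x17efbdba; 0x17efbdd6; 0x17ef7dda; 0x17efbbd3; 0x17efbdba; 0x17efbdd6; 0x17efbdd6;
0x17ef7dba; 0x17efbdd6; 0x17efbdd6; 0x17ef7dda; 0x17efbdba; 0x17ef7dda; 0x17efbdd6; 0x17ef7dda;
0x17dfbdda; 0x17ef7dda; 0x17efbdd9; 0x17ef7dda; 0x17dfbdda; 0x17efbdba; 0x17ef7dda; 0x17dfbdda;
0x17efbdd6; 0x17ef7dda; 0x17dfbdda; 0x17efbbd3; 0x17dfbdda; 0x17efbdba; 0x17dfbdda; 0x17efbdd6;
0x17dfbdda; 0x17ef7dae; 0x17dfbdda; 0x17ef7dba; 0x17efbdd6; 0x17ef7dba; 0x17dfbdda; 0x17efbdd6;
0x17efbdd6; 0x17dfbdda; 0x17ef7dda; 0x17dfbdda; 0x17efbdba; 0x17ef7dda; 0x17dfbdda; 0x17efbdd6;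
0x17ef7dda; 0x17dfbdda; 0x17efbbd6; 0x17dfbdda; 0x17efbdba; 0x17dfbdda; 0x17efbbd6; 0x17dfbdda;
0x17dfbdda; 0x17efbbd6; 0x17efbbd6; 0x17dfbdda; 0x17efbdd9; 0x17efbbd6; 0x17efbdba; 0x17efbbd6;
0x17efbbd6; 0x17dfbdda; 0x17efbbd6; 0x17efbbd6; 0x17efbbd6; 0x17dfbdda; 0x17ef7dba; 0x17efbbd6;
0x17ef7dba; 0x17ef7dba; 0x17efbbd6; 0x17ef7dba; 0x17efbbd6; 0x17ebb7de; 0x17efbbd6; 0x17efbbd6;
0x17ef7dba; 0x17efbbd6; 0x17ef7dba; 0x17eebede; 0x17efbbd6; 0x17ef7dba; 0x17dfbbd6; 0x17dfbbd6;
0x17dfbbd6; 0x17dfbbd6; 0x17dfbbd6; 0x17ef7dba; 0x17efbdd9; 0x17ef7dd9; 0x17eed3ef; 0x17ef77cd;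
0x17efb79d; 0x17ef7dba; 0x17eefbd3; 0x17eefbd3; 0x17eed3ef; 0x17ef77cd; 0x17efb79d; 0x17ef77cd;
0x17eef7cb; 0x17ef7dba; 0x17ef7dba; 0x17eed3ef; 0x17ef7dba; 0x17dfbdda; 0x17efbbd6; 0x17dfbdda;
0x17ef7dd9; 0x17ef7dd9; 0x17eef7cb; 0x17eef7cb; 0x17efbbd6; 0x17dfbdda; 0x17dfbdda; 0x17efbbd6;
0x17efbbd6; 0x17dfbdda; 0x17efbdd9; 0x17efbbd6; 0x17ef7dd9; 0x17ef7dd9; 0x17ef7dd9; 0x17ef7dd9;
0x17efbbd6; 0x17ef7dd9; 0x17efbbd6; 0x17dfbdda; 0x17efbdb9; 0x17dfbdda; 0x17eed3ef; 0x17efbbd6;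
0x17dfbdda; 0x17dfbdda; 0x17efbbd6; 0x17efbbd6; 0x17dfbdda; 0x17efbbd6; 0x17efbbd6; 0x17efbbd6;
0x17dfbdda; 0x17ef7dda; 0x17dfbdda; 0x17efbdba; 0x17ef7dda; 0x17dfbdda; 0x176bf7de; 0x17efbdd9;
0x17efbdba; 0x17efbdd9; 0x176bf7de; 0x176bf7de; 0x176bf7de; 0x176bf7de; 0x176bf7de; 0x17dfbdda;
0x176bf7de; 0x17ef7dda; 0x17efbdd9; 0x17ef7dda; 0x17efbdba; 0x17ef7dda; 0x17efbdd9; 0x17ef7dda;
0x17ef7dda; 0x17dfbdd9; 0x17ef7dda; 0x17eed3ef; 0x17ef7dda; 0x17dfbdda; 0x17ef7dda; 0x17efbdd9;
0x17efbdd9; 0x17ef7dda; 0x17dfbdda; 0x17efbdba; 0x17ef7dda; 0x17dfbdda; 0x17efbdd9; 0x17dfbdda;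
0x17ef7dda; 0x17eed3ef; 0x17eed3ef; 0x17dfbdda; 0x17ef7dda; 0x17dfbdda; 0x17efbbda; 0x17ef7dda;
0x17dfbdda; 0x17efbdd6; 0x17efbbda; 0x17ef7dda; 0x17dfbdda; 0x17efb5ee; 0x17dfbdda; 0x17efbbda;
0x17dfbdda; 0x17ef7dd9; 0x17ef7dd9; 0x17dfbbda; 0x17edf3d7; 0x17dfbdd6; 0x17efb5ee; 0x17bbf7da;
0x17dfbdda; 0x17efbbda; 0x17dfbdda; 0x17efbdd6; 0x17dfbdda; 0x17efbbda; 0x17dfbdda; 0x17efbdd9;
0x17efbbda; 0x17efb5ee; 0x17ef7dd9; 0x17ef7dd9; 0x17ef7dd9; 0x17efbdd6; 0x17ef7dd9; 0x17dfbdd6;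
0x17efb5ee; 0x17dfbdda; 0x17efbbda; 0x17dfbdda; 0x17efbdd6; 0x17efbdd6; 0x17dfbdda; 0x17efbbda;
0x17dfbdda; 0x17ef7dda; 0x17dfbdda; 0x17efbbda; 0x17dfbdda; 0x17ef7dda; 0x17efbdd9; 0x17efbbda;
0x17ef7dda; 0x17dfbdda; 0x17efbdd9; 0x17ef7dda; 0x17dfbdda; 0x17efbbda; 0x17dfbdda; 0x17ef7dda;
0x17efbdd6; 0x17ef7dda; 0x17dfbdda; 0x17efbbda; 0x17dfbdda; 0x17ef7dda; 0x17efbdba; 0x17efbbda;
0x17ef7dda; 0x17dfbdda; 0x17efbdd6; 0x17efbbda; 0x17ef7dda; 0x17dfbdda; 0x17efbdba; 0x17ef7dda;
0x17dfbdda; 0x17efbbda; 0x17dfbdda; 0x17ef7dda; 0x17efbdd9; 0x17efbbda; 0x17ef7dda; 0x17dfbdda;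
0x17efbdba; 0x17ef7dda; 0x17dfbdda; 0x17efbbda; 0x17dfbdda; 0x17ef7dda; 0x17efbdd6; 0x17ef7dda;
0x17dfbdda; 0x17efbbda; 0x17dfbdda; 0x17ef7dda; 0x17efbdba; 0x17dfbdda; 0x17ef7dda; 0x17efbbda]%positive.

Definition weightings : seq positive := [::
0x101; 0x3fffffffffffffffa07fffffff; 0xfffffffffffffff907fff;
0x1fff94a52fc494497c49892f0080406184218c51ff; 0xfffc24a125f0928497c24a12500804021084210920a3f;
0x3fffffff94a52cd9bf199bff800438199f855ff; 0x3ffff125125125125ffffffc15f;
0x3ffff294a5294a5fffffe0af; 0xffffffffffff82b; 0x3ff5555fffffffffffffc29f; 0x3fffffffe0a;
0x3ffff294a5294a5fffffffc15f; 0x3ffff294a5294a5fffffe0af; 0x3ffff294a5294a5fffffff057;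
0x3ffff294a5294a5ffff82b; 0xffffffffffff82b; 0xffffffffffff82b; 0xffffd55555557ffffff057;
0xffffffffffff82b; 0xffffc24a1250928497ffff82b; 0x3ffff294a5294a5ffff82b; 0x3ffff294a5294a5ffff82b;
0x7fffe125092849424bffffc15; 0xffffd55555557ffffc15; 0xffffc24a1250928497ffff82b;
0xffffc00101010804212010848497fffc15; 0x7fffe00410220442402109092ffffc15;
0x3ffff01084849404212125ffffc15; 0x7fffe125092849424bffffc15; 0xffffd55555557ffffc15;
0xfffffffffff04108210a08428542110888444400002040810204081020002a8f; 0x3ff5555fffffffffffffc29f;
0xffffffffffff817; 0xffffca5294a5ffe00181ff82b; 0x3ffffffffc0421fc666c4fff0a7;
0x3ffff092849424ffff8061ffff057; 0xffffffffffff817; 0x3ff7f849424a127fffe0183ffff057;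
0x3ff2fe1212528484ff2c030fff82b; 0xffffca5294a5ffe00181ff82b; 0xffffca5294a5ffe00181ff82b;
0x7fffe12509284943ff8004081ffc15; 0xffcbf8110909281109ff867fff82b; 0x3ff2fe1212528484f2fc030fff82b;
0x3fffffffe05; 0xffffc008204408848042121fc0887ffc15; 0x1ffff80842424a021090ff802083ffc15;
0x7fffe12509284943ff8004081ffc15; 0xffcbf8110909281109ff867fff82b;
0x1ffffffffe010811008408e010811fffe1cfe2a7; 0x7feffffffffffffffffffc29f; 0xfffffffca5fffffffffe28f;
0xffffffffffffff853; 0x7fe24a27fffffffffffff0a7; 0x3ff249ffffffffffffffe14f; 0xffffffffffffff853;
0x7fe24a33fffffffffffff0a7; 0x1ffff8221227ffff8e8efffff057; 0x7fffe010848497ffffffff82b;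
0x7fffe0442424bffe199bfff82b; 0xffffc24a125fff8061867ff82b; 0x3ffff9b366cdffffffe0b7;
0xffffc08211ffffffffffffe0af; 0xffffc24a125fff8061867ff82b; 0x7fffe088909ffffe3b9fffff057;
0x7fffe010848497ffffffff82b; 0x7fffe0442424bffe199bfff82b; 0x7fffe0442424bffe199bfff82b;
0xffffc24a125fff8061867ff82b; 0x3fffffffe05; 0x3fffffffe05; 0x7fffe021090928087ff004104411ffc15;
0x7fffe021090928087ff004104411ffc15; 0x7fffe010848497ffffffff82b; 0xffffc02102204427ffffffff82b;
0x7fffe0442424bffe199bfff82b; 0xfffffffffff39ffffe15b; 0x3fffffffe05; 0xffffc02109ffffffffff82b;
0xfffffffffffffff853; 0x3ffffb6db6dffffffffff09b; 0xffffffca5297fffffe15b;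
0xffffedb6db7fffffffff05b; 0x1ffffffffffceffffe15b; 0xffffffffffedfffffffc2b7;
0xffffedb6db7fffffffff09b; 0xfffffffffff39ffffe15b; 0x3fffffffe05; 0xffffc02109ffffffffff82b;
0xfffffffffffffff853; 0x3ffffffffff198cfffff0ad; 0x3ffff02213fffc333619fff82b;
0xffffedb6db7fffffffff05b; 0x3ffff0084021ffffffffff82b; 0xffffc08811fffe19c33867ff82b;
0x3ffffb6db6dffffffffff05b; 0x3fffffffe05; 0x3fffffffe05; 0x3fffffffe05; 0xffffc02109ffffffffff82b;
0x3fffffffe05; 0x3fffffffe05; 0x7fffe010811ffffffffff82b; 0x7ffffffffff89ffffff0ad;
0x3ffff02213fffc333619fff82b; 0x3fffffffe05; 0x1ffffc18c660c7ffff831fffff05b;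
0x7fffe11fcbffebffffffffff954f; 0x3fffffffe05; 0x3fffffffe05; 0x1fffffffffff13ffffff0ad;
0x3fffffffe05; 0xfffad6dc462318c9533208a6b8428542185444400100259249204002810550f;
0x3fffffffffffffffe14f; 0x1ffffffff8110ff1997fff0a7; 0xffff94a5294bffffff82b; 0xfffffffffffff82b;
0xfffffffffffff82b; 0x1ffff555557fffffffff057; 0xfffffffffffff82b; 0xffffffffffffffff853;
0xffff94a5294bffffff82b; 0xffff94a5294bffffff82b; 0xffff849424a1250ffffffc15;
0x7fffd555555ffffffc15; 0x7fffc24a125092fffffff82b; 0x1ffff000404042010848042121fffffc15;
0xffff8010408811090084243fffffc15; 0x7fffc042121250108487fffffc15; 0xffff849424a1250ffffffc15;
0x7fffd555555ffffffc15; 0x7e5feffffe294528a51b14a363c00001002000ff155; 0x3ff55ffffffffffffffe14f;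
0x7ffff87ffb7fddffffff147; 0x3ff294a5ffffffffff853; 0xffffffffffffff853; 0x3ff556ffffffffffffff0a7;
0x3ff294a5ffffffffff853; 0xffffffffffffff853; 0xffff94a52fffe0187fff82b;
0xffff849424a13ffe00841fffc15; 0xffca5fffffe19fffff853; 0x7e5fd6125092fffc33ffff82b;
0xffff94a52fffe0187fff82b; 0xffff844489fffff19ffffff057; 0x7e5fd6125092fffc33ffff82b;
0xffff94a52fffe0187fff82b; 0x7fffc212495087ffc018307ffc15; 0xffca5fffffe19fffff853;
0xffff81109092fffffffff82b; 0x7e5fd6125092fffc33ffff82b; 0x3fffe004102204424021ff147fffc15;
0x3fffe004082204224021ff127fffc15; 0x3fffe021090928087ff0223fffc15; 0x3fffe021090928087ff0223fffc15;
0xffff849424a13ffe00841fffc15; 0xffff849424a13ffe00841fffc15; 0xffff81109092fffffffff82b;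
0x1ff89ffffffffffffffe15b; 0x3ff125125fffffffffffff0ad; 0xffffffffffffffff82b;
0xffca5ffffffffffff853; 0xfffffffffffffff853; 0x3ffff77ddfffffffffff09b; 0x3fffe125ffff0ccdffff82b;
0x3ffffffed6ff0041c010408ff8008d2bffe09f153; 0xfdbffffffc95256226bfe003fe042e2ab;
0x3fffe125ffff0ccdffff84b; 0x7fffffff125125ffffe021fffff0ab; 0x3fffffff804212125ff092fff855;
0xffffffffffffffff82b; 0xffca5ffffffffffff853; 0xffffffffffffffff853; 0x1ffff02213ffffffffff82b;
0xfffffffffffffff853; 0xffffffffffffffff82b; 0xffff811023ffffffffff82b; 0xffff8484ffff8670cffff82b;
0x7fffc04212127ffc084489fffc15; 0x7fffc04212127ffc084489fffc15; 0x3fffffff804212125ff092fff855;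
0xffffffffffffffff82b; 0x7fffc041042088fff810848e07ffc15; 0x7fe5294ffe1ffffffffffff0ad;
0xffffffffffffffff82b; 0xffffffffffffffff82b; 0x1ffff02213ffffffffff82b;
0x7fff9789eb000273cbf295f2ffb7ff22b; 0xffffffffffffffff82b; 0x3fffffffdef7de13f9d3f1e045fe7f12d;
0x3fffffff804212125ff092fff855; 0x3f7ff8665fffffc67ffffff09b; 0xffffffffffffffff853;
0x3f2ffbfffffffffffffffff156; 0xffffffffffffffffff8aa; 0xffcbfffefffffffffffff0ab;
0xffffffffffffff853; 0x3ff0928497ffffffffff853; 0x3ff294a5ffffffffff853; 0x7fff2fffffffffffe2ab;
0xffffffffffffff853; 0xffffffffffffff82b; 0x3fffc24a125fffffffff82b; 0x3fffca5297ffffffff82b;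
0x3fffca5297ffffffff82b; 0x7fff849424a13fffffffc15; 0x3fffd55557fffffffc15; 0xfffffffffffffff8a3;
0x3fffca5297ffffffff82b; 0xffffffffffffff82b; 0x3fffc24a125fffffffff82b; 0x3fffca5297ffffffff82b;
0x1fffe10924a843fffffffc15; 0x3fffd55557fffffffc15; 0x3fffd55557fffffffc15; 0xffca5fffffe19fffff853;
0xffff002081102212010fffffffc15; 0xffff002041102112010fffffffc15; 0x7fff80842424a021fffffffc15;
0x7fff80842424a021fffffffc15; 0x7fff849424a13fffffffc15; 0x7fff849424a13fffffffc15;
0x3fffd55557fffffffc15; 0x3fffca5297ffffffff82b; 0x7fff849424a19fffffffc15; 0x3fffd5555bfffffffc15;
0xfffffffffffffff8a3; 0xfffffffffe19848623335070b16bfe8a7; 0xffff294cfffffffffffff057;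
0xffffffffffffff853; 0x3ff0928497ffffffffff853; 0x3ff294a5ffffffffff853; 0x3fffca5297ffffffff82b;
0xffffffffffffff82b; 0x3fffc24a125fffffffff82b; 0x3fffca5297ffffffff82b; 0xffffffffffffff82b;
0x3fffca5297ffffffff82b; 0x3fffc2424a5fffffffff82b; 0x3fffca5297ffffffff82b;
0x1fffe121252861fffffffc15; 0x3fffd5555bfffffffc15; 0x3fffd5555bfffffffc15; 0xffca5fffffe19fffff853;
0x7fff8421092499fffffffc15; 0x3fffd5555bfffffffc15; 0x3fffc2424a5fffffffff82b;
0x7fff80842424a030fffffffc15; 0xffff0020408411120187ffffffc15; 0x7fff80842424a030fffffffc15;
0x7fff849424a19fffffffc15; 0xffff0104108222418fffffffc15; 0x7fff849424a19fffffffc15;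
0x3fffd5555bfffffffc15; 0xfffffffffffffff853; 0x7ffffff804212125ffffff855;
0x1fffe125093fff8111ffffc15; 0xffffffffffffffff853; 0xfffffff297fffffff8a3;
0x3ffffffffc24a125092fffff800408118aa; 0x7fff8497ffffffffff82b; 0xffffffffffffffffff8aa;
0x7fe5294fff03ffffffffffff0ab; 0x7fff8497ffffffffff84b; 0xfffffffffffffff893;
0x7ffffff804212125ffffff855; 0x1fffe121253fff811c7fffc15; 0xffffffffffffffff853;
0xfffffff0928497ffffff855; 0xffffffffffffffff82b; 0xffca5ffffffffffff853; 0xffff297fffe19fffff82b;
0x7fe5294fff03ffffffffffff0ab; 0xffffffffffffffff855; 0x7fff8497ffffffffff82b;
0x7fff8497ffffffffff84b; 0xfffffffffffffff893; 0x3fffc2427ffffffffff82b; 0xfffffffffffffff853;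
0x7ffffff804212125ffffff855; 0x1fffe10924bfff818c7fffc15; 0x1fffe125093fff8111ffffc25;
0xffffffffffffffff82b; 0xfffffff0928497ffffff855; 0xffffffffffffffff82b; 0xffffffffffffffff84b;
0xffca5ffffffffffff853; 0x1fffe1084249fffc0e381fffc15; 0xffffffffffffffff82b; 0xffffffffffffffff82b;
0x3fffc2427ffffffffff82b; 0x7fff80842424fff893ffffc15; 0x7fff80842424fff893ffffc15;
0x7fff80842424fff893ffffc15; 0x7ffffff804212125ffffff855; 0x1fffe125093fff8111ffffc15;
0x7fff8082087fff1251c7fffc15; 0x3fffc041042088fff8a3ffffc15; 0x3ffffffc24bfff8497fff855;
0x1fffe125093fff8111ffffc15; 0x3ffffffc24bfff8497fff855; 0x1fffe125093fff8111ffffc15;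
0xfffffff0928497ffffff855; 0xffffffffffffffff82b; 0xfffffff2d2fff11ebe5c2fff2652b;
0x7fe5294fff03ffffffffffff0ab; 0xfffffffffffffff853; 0xfff37fff804228a9fd1297fffec27;
0xffff297fffe19fffff82b; 0x7fffff97ffffffffffe157; 0xffffffffffffffff853; 0x7fff8497ffffffffff82b;
0xfffffffffffffff853; 0x7ffffff804212125ffffff855; 0x1fffe10924bfff818c7fffc15;
0xffffffffffffffff853; 0xfffffff0928497ffffff855; 0xffffffffffffffff82b; 0xffca5ffffffffffff853;
0x7fff8497ffffffffff88b; 0xffff297fffe19fffff88b; 0xffffffffffffffff82b; 0x7fff8497ffffffffff82b;
0xffffffffffffffff82b; 0x3fffc2427ffffffffff82b; 0x3ffffffff80125f3586a7c96ffdfff453;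
0xffff297fffe19fffff82b; 0x3ff0e73bff800606063008424a500c302219848497a15;
0x1fffe1092109fffc0c781fffc15; 0x3fffebaffffffffffffff05b; 0xffffffffffffffff82b;
0x7ffffffe01861980421300c2940c6044c97ffa15; 0xffffffffffffffff82b; 0xffffffffffffffff82b;
0x7fff8497ffffffffff82b; 0x7fff80842424fff893ffffc15; 0x7ffffff804212125ffffff855;
0x1fffe125093fff8111ffffc15; 0x3fffc041088108fff893ffffc15; 0x3ffffffc24bfff8497fff855;
0x1fffe125093fff8111ffffc15; 0x3ffffffc24bfff8497fff855; 0x1fffe125093fff8111ffffc15;
0xfffffff0928497ffffff855; 0xffffffffffffffff82b; 0xfffffffffc24a125f84ffc0082047f8aa;
0x1fffff8497008427ff8061e0041023fff895; 0xffffffffffffffffff8aa; 0xffffaebfffffffffffff05b;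
0xffffffffffffffff82b; 0xfffffffffc02097ffc02ffbff7ff153; 0xfffffff09090909ffffe0187c030f855;
0x1fffff8497008427ff8061e0041023fff895; 0xfffffff09090909ffffe0187c030f855;
0x3fffef7fffffffffffff05b; 0xffffffffffffffff853; 0x7ffffff804212125ffffff855;
0x3ffffffc24bfff8497fff855; 0x3ffffffc088494bff092f867ff855; 0x3ffffffc24bfff8497fff855;
0xfffffff0928497ffffff855; 0x3fffcb2fc4c4fa2a2a100ffe13f9fcb638eee0923a8e;
0x3ffefffca5d00482161881e60c6fc31ffffffd25b; 0xfcdffffffffff5ffffffffe8a7;
0x7fedbff8061c0c20c44c0c62af79fffff42b; 0x3f7ff7efefd7f2a109aa5572abafebfff6a55;
0x3fffddfe0a8576135868af3ebc33fffffe92d; 0xffffff39ffffffffe15b; 0xffffaebfffffffffffff09b;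
0xffffaf5fffffffffffff05b; 0xffffffffffffffff82b; 0xfffff6f6fe1fffffffcfafffe2ad;
0x7ffe4ffffffffffffffffe2a7; 0x3ffffffc24bfff8497fff855;
0xffff77ff003060108184260184a873830fa7ffa15; 0x3ffeeeffe018606103084c03095030c184112bffa15;
0x3ffff37ffff1978c5d7997f8bfffe956; 0x7ffffeffffe5fffffffff97456; 0xffffffffffffffff84b;
0xffc39ceffe00181806081842408a806181840c2120457a15; 0x3ffffffc24bfff8497fff855;
0xffffbdffffffffffffff05b; 0xffffffffffffffffff8aa; 0xffca5ffffffffffff853; 0xffc24bfffffffffffc2a;
0xffd57fffffffffffc2a; 0x3fff849424fffffffffc15; 0x7fefffffffffffffc2a; 0xffffffffffffffff8aa;
0xfffe52fffffffffff82b; 0xfffffffffffffff82b; 0x7fe010848497ffffffffff855;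
0xffc24a125fffffffffff855; 0xffffffffffffffff82b; 0x7fe125ffffffffffff855; 0xffffffffffffffff855;
0xfffe52fffffffffff82b; 0xfffffffffffffff82b; 0x7fe125ffffffffffff855; 0xffffffffffffffff855;
0xfffe52fffffffffff82b; 0xffffffffffffffff82b; 0xfffe52fffffffffff82b; 0xffffffffffffff855;
0xffd57fffffffffffc2a; 0x3fff848494fffffffffc15; 0x1ffbffffffffffffc2a; 0x3fff849424fffffffffc25;
0x7fefffffffffffffc2a; 0xfffd57ffffffffffc15; 0xfffffffffffffff855; 0x1fffd555fffffffffc15;
0x7fe010848497ffffffffff855; 0x1fffd555fffffffffc25; 0xffffffffffffffff82b;
0x7fff0842124fffffffffc15; 0x1fffd555fffffffffc15; 0xffffffffffffffff82b;
0x1fffc04212127ffffffffc15; 0x1fffc04212127ffffffffc15; 0xffffffffffffff855; 0xffd57fffffffffffc2a;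
0x3fff849424fffffffffc15; 0x3fff0fffffffffffc15; 0x3fff8082087fffffffffc15;
0xfffe0208210447ffffffffc15; 0xfffc24bffffffffffc15; 0xfffe125ffff15fffffc15;
0x3fff849424fffffffffc15; 0xfffd57ffffffffffc15; 0xfffffffffffffff855; 0x1fffd555fffffffffc15;
0xffffffe25e2708c4d7f97c12ffdfff22b; 0xffca5ffffffffffff853; 0xfffffffffffffff853;
0x7fe125ffffffffffff855; 0xffffffffffffffff84b; 0xfffe52fffffffffff82b; 0xffffffffffffff855;
0xffd75fffffffffffc2a; 0x3fff842492fffffffffc15; 0x7fefffffffffffffc2a; 0xffdb6fffffffffffc29;
0xfffffffffffffff855; 0x1fffd555fffffffffc15; 0xffffffffffffffff853; 0xfffffffffffffff88b;
0x1ffff8497ffff00c3867fffff895; 0xffffffffffffffff82b; 0xffffffffffffffff82b;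
0xfffe52fffffffffff82b; 0x7ffe1384ffffffffffc15; 0x1fffc2709fffc5f1ffffc15;
0x7fff0909090fffffffffc15; 0xfffd75ffffffffffc15; 0x7ffff8497f0cffc030f0020811ca5ff84895;
0x3ff092ff8497fffffffff855; 0x1fffd555fffffffffc15; 0x7fe010848497ffffffffff855;
0xffc24a125fffffffffff855; 0xffffffffffffffff82b; 0xffffffffffffffff82b; 0xfffe52fffffffffff82b;
0x3fff55ffffffffffc15; 0x7fff0849084fffffffffc15; 0x3ff092ff8497fffffffff855;
0x1fffd555fffffffffc15; 0x3ff092ff8497fffffffff855; 0x1fffd555fffffffffc15;
0xffc02109ffffffffffff855; 0xffffffffffffffff82b; 0x1fffc04212127ffffffffc15; 0xffffffffffffff855;
0xffd75fffffffffffc2a; 0x3fff849424fffffffffc15; 0xfffe0210440887ffffffffc15;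
0x1fff8444ffffffffffc15; 0xfffe0208440847ffffffffc15; 0x7ffe1384ffffffffffc15;
0x1fffc2709fffc51fffffc15; 0x3fff55ffffffffffc15; 0x3fff849424fffffffffc15; 0x7ffe1384ffffffffffc15;
0x1fffc2709fffc51fffffc15; 0x3fff849424fffffffffc15; 0xfffd75ffffffffffc15; 0xfffffffffffffff855;
0x1fffd555fffffffffc15; 0xfffe52fffffffffff88b; 0xfffffffff297ffffffc27f8a9;
0x7fff55ff07c0387249d57ffc45; 0xffc24be125ffffffffffff895; 0xffffffffffffffff88b;
0x3ffffff811c272e06337023023ffff915; 0x1ffffffc27c27f8061c330086047fff915; 0xffffffffffffffff853;
0xffffffffffffffff855; 0xffffff94a52fffff0cfff855; 0xfffd57ffffffffffc15; 0xffffffffffffffff855;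
0xffffffffffffffff855; 0xffffff94a52fffff0cfff855; 0xfffd57ffffffffffc15; 0xffffffffffffffff855;
0x7fe010848497ffffffffff855; 0xffc24a125fffffffffff855; 0x3fffffe0440894bffff0cff0cff855;
0xfffffffff8494bffffff09e13929; 0x7fff08421ffff1c71ffffc15; 0xffffff94a52fffff0cfff855;
0xffffff94a52fffff0cfff855; 0xffffffffffffffff855; 0xffc24a125fffffffffff855; 0xffffffffffffff855;
0xffd57fffffffffffc2a; 0xfffc24bffffffffffc15; 0xfffe125ffff15fffffc15; 0x1ff8497fca5ffffffffff855;
0xffffffffffffffff84d; 0x3ff0928497ca5297ffffffff855; 0x1fffc07ffffffffffc15; 0x3fff0fffffffffffc15;
0x3fff8082087fffffffffc15; 0x7fefffffffffffffc29; 0xffffffffffffffff855; 0x7fefffffffffffffc29;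
0xffffffffffffffff855; 0xfffc24bffffffffffc15; 0xfffe125ffff15fffffc15; 0xffd57fffffffffffc29;
0xfffffffffffffff855; 0x77ffff250cce822356008628830b5c3c18800041222921fe7c01eaa3;
0x3ffff5ad6baffc235810c11f911fc7fff253; 0xfffffffffffd5affffff255; 0xfffffffffffffff84b;
0xffffffffffffffff923; 0xffffffffffffffff84b; 0xfffe52fffffffffff84b; 0xffffffffffffffff82b;
0xfffe52fffffffffff82b; 0xffc27cbff0996132e19e5fffff915; 0xffffffffffffffff82b;
0xffc27cbff00861309965f8043811fff915; 0x1fffd55ddffffffffc15; 0x3ffff092ffffffffff849095;
0x1ffff297ff97ffffc17effff24d; 0x1fffdbffffffffffffff24d; 0xffc24a125fffffffffff855;
0xffffffffffffffff855; 0x1ffffffc08c261309867fffffff915; 0x7fffe5ffffc33ff297fffff92a;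
0x3ff2ffff0087023023098061864bfffff915; 0xffffffb7ffffffffffffe556; 0x7ffffffff9bff2fcbffff92a;
0xfffffffffffffffffff92a; 0x1fffe5ffffffffffffffe51b; 0xffffffffffffffff88b;
0x3ffcbfffdf0041c020c4c49fffffffe4ab; 0x1ffff97c261386427fff00081fc0083fcb945;
0xfffffffffffffffff855; 0x7fe5fcbe13090ce06213257fe00103f801060041ff945;
0x7fffee7f0f8c6d84b4affe2a38ff7ff513; 0x7fe125fffffffffffff855; 0xfffffffffffffffff855;
0xffffffffffffffff855; 0x7fff7fffffffffffffff05b; 0x3ffffff8043811023098189bffffff915;
0x1ff97fff804381181184c030c33fffff915; 0x7fffffffc0872ff2ff2ffffe656;
0x1ffffffffe001e37dafffffff255; 0xffffffffffffffff923; 0xfffffffffffffff855;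
0x7fffffc24bffffffff855; 0x3ffff092ffffffffff849095; 0x7ffffff0020e01081184c03097ffffff915;
0x3ffffff801060460461300c25ffffff915; 0xfffd57ffffffffffc15; 0xffffffffffffffff855;
0xfcfffffffffffffffffff256; 0xfffffffff0cfffffff855; 0x3fffffffffe5fffffffcb92a;
0xfffffffffffffffffff92a; 0xfffffffffff2fcbf965f92a; 0xffffffffff0cffffff855;
0x3ffffffe0109094091402428110992d038ffffa85; 0xffffffffffffffff855; 0xffffffe596597ffffe0187f915;
0x7fffffe810311863bc030c32a00c080c10093fffa15; 0x7ffffffc0300c02186109450290a04400f203a801c0fffa85;
0xfffffffffffffffff855; 0xfffffffffffffff855; 0x7fffffc24bffffffff855;
0x7feeeefe8018218ef00c25466320917fffa15; 0xfffd57ffffffffffc15; 0xffffffffffffffff855;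
0x3fffffffffff2ffffe5f92a; 0x3ff092ff8497fffffffff855; 0xffffffffff0cffffff855;
0x1ffffffc0083023023098061ffffff915; 0x3ff09f2ffc021c08c08c26018797ffff915;
0x3ffffff8010604604613fc265ffff915; 0xffffffd0e70c778061540c2188625f5f215;
0xffcfffffffffffffffff22d; 0xffffffffffffffff855; 0xffffffe0461302309867ffffff915;
0x3ffffff84e1302309867f0997fff915; 0xfffc24bffffffffffc15; 0xfffe125ffff15fffffc15;
0xfffc24bffffffffffc15; 0xfffe125ffff15fffffc15; 0xfffffffffffffff855; 0x7fffffc24bffffffff855;
0xffffffe00418118118497e1384ffff915; 0xfffd57ffffffffffc15; 0xfff2e5ffffffe5ffff2f92a;
0x7febafffc02040844402a0402a040885247201d03fffa85; 0xffffffffffffffffff8a9; 0xfffffffffffffff855;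
0x7fffffc24bffffffff855; 0xffffffcbfff97fffff2e594a; 0xffffffffffffffffff8a9;
0x7fffffffe125fffffffff8a9; 0xffff297ffffffffffc278a5; 0x3fffffffff867e19fffff895;
0x7fefffffffffffffc29; 0x7fefffffffffffffc29; 0xffffffffffffffff855; 0xffffffffffffffff855;
0xfffd57ffffffffffc15; 0x7fe010848497ffffffffff855; 0xffffffffffffff855; 0xffffffffffffffffff8a9;
0xffffffffffffffffff8a9; 0x7fefffffffffffffc29; 0x3ff0221204427fffffffffff855;
0x7fefffffffffffffc29; 0xfffc24bffffffffffc15; 0xffd57fffffffffffc29; 0x7fefffffffffffffffffff12b;
0x3ff2fe5972fffffffffff915; 0xfffffffffffffffff895; 0x7fe125fffffffffffff855;
0xfffffffffffffffff8aa; 0xffffffffffffffff8aa; 0xfffffffff0cfffffff855; 0xffffffffffffffff8aa;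
0x3ffff092ffe125ffffffffff8aa; 0x1ffffffffc02109c24bfffffff8aa; 0xfffffffffff0928497fc24a125f954;
0xfffffffff97fe125ff0225ff92a; 0xffc24a125fffffffffff855; 0x7fffff81109ca5ffffffff895;
0x3ffff092ffe125fffffffff8aa; 0x7fff8497ffffffffffff8aa; 0x7fe797e37c5f2f2effffffffff293;
0xfffffffffff2cbff84fff929; 0xfffffffffffffffff895; 0xffff297fffffe01084fffff8a5;
0x7fe125fffffffffffff855; 0x7fe125fffffffffffff855; 0xffffffffffffffff855; 0xfffffffffffffffff895;
0x7fe125fffffffffffff855; 0x7ffdffffffffffffc25; 0x7ffdffffffffffffc25; 0xfffffffffffffff855;
0x7ffdffffffffffffc15; 0x3ffff092fc33e04427ffffffff8aa; 0x1fffffff811fe5ffc24bffff92a;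
0xffffffffe5ffc24bf8112ff92a; 0xfffd57ffffffffffc15; 0x3ffffca5ca5fffffffff895;
0xffffffff97fff2fe5f2f92a; 0xfffffffff0cfffffff855; 0xffffffe52fffffc27ff895;
0xffffffe52fffffc27ff895; 0xffffffffe19fffffffff8a5; 0x7fe04424a5ffffffffffff855;
0xffffff2ff97fff97f2ff92a; 0x7ffdffffffffffffc15; 0x3fffcbffffe018784cb2cbfff915;
0xfffd57ffffffffffc15; 0xffffff297ffffff867ff895; 0xffffffff94bfffffc27ff8a9;
0x7fffff81109ca5ffffffff895; 0xfff2fc33e5f09c27ffffffff92a; 0xfffc24bffffffffffc15;
0x7ffdffffffffffffc25; 0x3ff0909297fffffffffff855; 0x7ffdffffffffffffc25; 0xfffffffffffffff855;
0x3fffffc0082047fffffffff895; 0x7ffdffffffffffffc15; 0xfffffffffffffffff8aa; 0xfffd57ffffffffffc15;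
0x1ffffff84cbc08e0470994bffff945; 0x3fffffff09ff2f2fffffe5e594a; 0x1ffff80421300c25fffffffffff8aa;
0x1fffe125867fffffffffff8aa; 0xffffffffffffffffff8aa; 0x3ff294a5ffffffffffff855;
0xffffffffffffffff855; 0xfffffffffffffffff8a9; 0xffffffe19ffffffffff8a9; 0x7ffdffffffffffffc25;
0xfffffffffffffff855; 0x1ffff3b831e1283184efeffffffffffe955; 0x3ffffcbfff811fffff965ff92a;
0x7fe52ffc021fc08ca5ffffffff945; 0x3ffffab0be2e07ffffffff925; 0x3fffcbfcb97f97fffffff94a;
0xffffffffffffffff8aa; 0x7e125ffffffffffffff8aa; 0xffffffffffffffff8aa; 0x7ffdffffffffffffc15;
0xffffffffffffffff954]%positive.

(** * Soundness of shipping plans *)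

Lemma mem_subs p q : (q \in subs p) = below q p.
Proof.
elim: p q => [|b p IH] [|c q] //=; rewrite mem_cat.
  by case: b; rewrite ?in_nil; apply/negbTE; rewrite ?negb_or; [apply/andP; split|];
    apply/mapP => -[].
have map_consE d e : (d :: q \in map (cons e) (subs p)) = (d == e) && below q p.
  rewrite -IH; apply/mapP/andP => [[r rp [-> ->]]|[/eqP-> qp]]; first by rewrite eqxx.
  by exists q.
by rewrite map_consE; case: b; rewrite ?map_consE; case: c; rewrite ?andbF ?andbT ?orbF.
Qed.

Lemma subs_uniq p : uniq (subs p).
Proof.
have cons_inj (b : bool) : injective (cons b) by move=> ? ? [].
elim: p => [//|b p IH]; rewrite [subs _]/= cat_uniq (map_inj_uniq (cons_inj false)) IH.
case: b; rewrite ?(map_inj_uniq (cons_inj true)) ?IH andbT //=; last by apply/hasPn.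
by apply/hasPn => _ /mapP[q _ ->]; apply/mapP => -[].
Qed.

Lemma cube_uniq n : uniq (cube n).
Proof. exact: subs_uniq. Qed.

Lemma mem_cube n p : (p \in cube n) = (size p == n).
Proof.
rewrite mem_subs; elim: n p => [|n IH] [|b p] //=.
by rewrite -[RHS]IH; case: b.
Qed.

Lemma below_size p q : below p q -> size p = size q.
Proof. by elim: p q => [|b p IH] [|c q] //= /andP[_ /IH ->]. Qed.

Lemma get_tabulate X n (f : point_set -> X) p :
  size p = n -> get (tabulate n f) p = f p.
Proof.
elim: n f p => [|n IH] f [|b p] //= [sz].
by case: b; rewrite IH.
Qed.

Lemma get_upd X n (t : trie X n) p q x :
  size p = n -> size q = n -> get (upd t p x) q = if q == p then x else get t q.
Proof.
elim: n t p q => [|n IH] t [|b p] [|c q] //= [szp] [szq].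
by rewrite eqseq_cons; case: b; case: c => //=; rewrite IH.
Qed.

(** * Mass balance of a shipping plan against a downset *)

Section Transport.
Variables (n : nat) (D : pred point_set).

Definition total (r : trie nat n) := \sum_(p <- cube n | D p) get r p.

(** The additive form avoids truncated subtraction, and the factor [D q] treats sets inside and
    outside [D] at once. *)
Lemma total_upd r q y : size q = n ->
  total (upd r q y) + D q * get r q = total r + D q * y.
Proof.
move=> szq; have qin : q \in cube n by rewrite mem_cube szq.
rewrite /total !(big_mkcond D) /= !(bigD1_seq q) ?cube_uniq //= get_upd // eqxx.
have -> : \sum_(p <- cube n | p != q) (if D p then get (upd r q y) p else 0) =
          \sum_(p <- cube n | p != q) (if D p then get r p else 0).
  rewrite big_seq_cond [RHS]big_seq_cond; apply: eq_bigr => p /andP[].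
  by rewrite mem_cube => /eqP szp /negbTE nq; rewrite get_upd // nq.
by case: (D q); lia.
Qed.

(** Shipping only ever uses up room, wherever the targets lie. *)
Lemma ship_le x qs r c r' c' : all (fun q => size q == n) qs ->
  ship x qs r c = Some (r', c') -> total r' <= total r.
Proof.
elim: qs x r c => [|q qs IH] [|x] r c //=; try by move=> _ [<- _].
case/andP => /eqP szq szqs; case E: (get r q) => [|y]; first exact: IH.
case: c => // c; last exact: IH.
move/IH => /(_ szqs); move: (total_upd r (y.+1 - x.+1) szq); rewrite E.
by case: (D q); lia.
Qed.

(** When all possible targets lie in [D], every unit shipped is taken from room that [total]
    counts. *)
Lemma ship_eq x qs r c r' c' : all (fun q => size q == n) qs -> all D qs ->
  ship x qs r c = Some (r', c') -> total r = total r' + x.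
Proof.
elim: qs x r c => [|q qs IH] [|x] r c //=; try by move=> _ _ [<- _]; rewrite addn0.
case/andP => /eqP szq szqs /andP[Dq Dqs].
case E: (get r q) => [|y]; first exact: IH.
case: c => // c; last exact: IH.
move/IH => /(_ szqs Dqs); move: (total_upd r (y.+1 - x.+1) szq); rewrite E Dq.
by lia.
Qed.

Hypothesis D_down : forall p q, below p q -> D q -> D p.

(* If the set p lies in the downset D then so do all the sets its surplus is shipped to. *)
Lemma transport_le surplus ps r c : all (fun p => size p == n) ps ->
  transport surplus ps r c -> \sum_(p <- ps | D p) surplus p <= total r.
Proof.
elim: ps r c => [|p ps IH] r c /=; first by rewrite big_nil.
case/andP => /eqP szp szps; case E: ship => [[r' c']|] // /(IH _ _ szps) le_r'.
have szs : all (fun q => size q == n) (subs p).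
  by apply/allP => q; rewrite mem_subs => /below_size ->; rewrite szp.
(* For [p] outside [D] the surplus is not counted, while its shipment may still use room inside [D];
   an inequality suffices there. *)
rewrite big_cons; case: ifP => Dp; last exact: leq_trans le_r' (ship_le szs E).
rewrite (ship_eq szs _ E) 1?addnC ?leq_add2l ?leq_add2r //.
by apply/allP => q; rewrite mem_subs => /D_down/(_ Dp).
Qed.

End Transport.

(** * From weighted domination to a single winning star *)

Lemma weightE p w : weight p w = \sum_(i < size w) nth false p i * nth 0 w i.
Proof.
elim: w p => [|k w IH] [|b p] /=; rewrite ?big_ord0 //.
  by rewrite big1 // => i _; rewrite nth_nil.
by rewrite big_ord_recl /= -IH; case: b; rewrite ?mul1n ?mul0n.
Qed.

Definition down_closed (D : pred point_set) := forall p q, below p q -> D q -> D p.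

(** A position [i >= n] stands for an empty star, since [nth] then returns [false] on the whole
    cube. *)
Definition some_star_wins n (F : pred point_set) :=
  forall D : pred point_set, down_closed D ->
  exists i, count (fun p => F p && D p) (cube n) <= count (fun p => nth false p i && D p) (cube n).

(** The shipping plan bounds [N] times the number of common sets of [F] and [D] by the weighted sum
    of the star sizes of [D]. As [N] is the sum of the weights, some star is at least as large as
    the average. *)
Lemma majorizedP n (t : trie (option bool) n) c (F : pred point_set) :
  (forall p b, size p = n -> get t p = Some b -> F p = b) ->
  majorized t c -> some_star_wins n F.
Proof.
move=> tF; rewrite /majorized; case: read_unary => w c'.
set N := sumn w => /and3P[N_gt0 /allP t_total].
move=> tr D D_down.
have loadE p : p \in cube n -> load t N p = F p * N.
  move=> pin; have szp : size p = n by apply/eqP; rewrite -mem_cube.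
  move: (t_total p pin); rewrite /load; case E: (get t p) => [b|//] _.
  by rewrite (tF _ _ szp E); case: b {E}; rewrite ?mul1n.
have sz_all : all (fun p => size p == n) (rev (cube n)).
  by rewrite all_rev; apply/allP => p; rewrite mem_cube.
have := transport_le D_down sz_all tr; rewrite /total (perm_big (cube n)) /=; last first.
  by rewrite perm_rev.
have -> : \sum_(p <- cube n | D p) get (tabulate n (fun p => weight p w - load t N p)) p =
          \sum_(p <- cube n | D p) (weight p w - load t N p).
  rewrite big_seq_cond [RHS]big_seq_cond; apply: eq_bigr => p /andP[].
  by rewrite mem_cube => /eqP /get_tabulate ->.
move=> le1.
have le2 : N * count (fun p => F p && D p) (cube n) <= \sum_(p <- cube n | D p) weight p w.
  have -> : N * count (fun p => F p && D p) (cube n) = \sum_(p <- cube n | D p) load t N p.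
    rewrite -sum1_count big_distrr /= big_mkcondl /= [RHS]big_seq_cond.
    rewrite [LHS]big_seq_cond; apply: eq_bigr => p /andP[/loadE -> _].
    by case: (F p); rewrite ?muln1 ?mul1n.
  (* Adding the minimum of mass and capacity to both sides restores what truncation removed: surplus
     becomes the full mass, room the full capacity. *)
  have := leq_add le1 (leqnn (\sum_(p <- cube n | D p) (minn (load t N p) (weight p w)))).
  rewrite -!big_split /=.
  rewrite (eq_bigr (load t N)) => [|p _]; last by lia.
  by rewrite [X in _ <= X](eq_bigr (fun p => weight p w)) => [|p _]; last by lia.
set C := count _ _ in le2 *.
have [/existsP[i Ci]|/existsPn no_i] :=
  boolP [exists i : 'I_(size w), C <= count (fun p => nth false p i && D p) (cube n)].
  by exists i.
(* As [N > 0], this inequality forces [C = 0], and then position 0 serves. *)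
suff : N * C <= N * C.-1 by exists 0; nia.
(* Exchanging the sums over sets and over points turns the total weight into the weighted sum of
   star sizes, each at most [C.-1] by assumption. *)
apply: leq_trans le2 _; under eq_bigr => p _ do rewrite weightE.
rewrite exchange_big /= mulnC /N sumnE (big_nth 0) big_mkord big_distrr /=.
apply: leq_sum => i _; rewrite -big_distrl leq_mul2r /=; apply/orP; right.
have := no_i i; rewrite -ltnNge; set C' := count _ _.
suff -> : \sum_(p <- cube n | D p) nth false p i = C' by lia.
rewrite /C' -sum1_count [RHS]big_mkcondl /=.
by apply: eq_bigr => p _; case: nth.
Qed.

(** * Soundness of the search *)

Lemma below_refl p : below p p.
Proof. by elim: p => //= -[] p ->. Qed.

Lemma below_trans q p r : below p q -> below q r -> below p r.
Proof.
by elim: q p r => [|c q IH] [|b p] [|d r] //=; case: b; case: c; case: d => //=; apply: IH.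
Qed.

Lemma below_negb p q : below p q -> below (map negb q) (map negb p).
Proof. by elim: p q => [|b p IH] [|c q] //= /andP[bc /IH ->]; case: b c bc => -[]. Qed.

Lemma below_nth p q i : below p q -> nth false p i -> nth false q i.
Proof.
elim: p q i => [|b p IH] [|c q] [|i] //= /andP[bc pq]; last exact: IH.
by move=> b1; rewrite b1 in bc.
Qed.

Lemma below_count p q : below p q -> count id p <= count id q.
Proof. by elim: p q => [|b p IH] [|c q] //= /andP[bc /IH]; case: b c bc => -[]//; lia. Qed.

Lemma negb_setK p : map negb (map negb p) = p.
Proof. by rewrite -map_comp map_id_in // => b _ /=; rewrite negbK. Qed.

Definition up_closed (F : pred point_set) := forall p q, below p q -> F p -> F q.

(** Together with upward closure this makes [F] intersecting on the cube: a member disjoint from [p]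
    would put the complement of [p] into [F]. *)
Definition self_dual n (F : pred point_set) :=
  forall p, size p = n -> F (map negb p) = ~~ F p.

Definition agrees n (t : trie (option bool) n) (F : pred point_set) :=
  forall p b, size p = n -> get t p = Some b -> F p = b.

(** The membership vector along [vs] read as a binary number, first set most significant, so that
    lexicographic order becomes the order of naturals. *)
Fixpoint code (F : pred point_set) (vs : seq point_set) : nat :=
  if vs is v :: vs' then F v * 2 ^ size vs' + code F vs' else 0.

Lemma code_lt F vs : code F vs < 2 ^ size vs.
Proof. by elim: vs => //= v vs IH; rewrite expnS; case: (F v); lia. Qed.

(** * Invariance under relabelling of the points *)

Section Relabelling.
Variables (n : nat) (s : seq nat).
Hypothesis s_perm : perm_eq s (iota 0 n).

Lemma size_permute p : size (permute s p) = n.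
Proof. by rewrite size_map (perm_size s_perm) size_iota. Qed.

Lemma mem_relabelling i : (i \in s) = (i < n).
Proof. by rewrite (perm_mem s_perm) mem_iota. Qed.

Lemma nth_permute p i : size p = n -> nth false (permute s p) (index i s) = nth false p i.
Proof.
move=> szp; have [i_s|i_s] := boolP (i \in s).
  by rewrite (nth_map 0) ?index_mem // nth_index.
(* Here [i >= n], so both sides read past the end and give the default [false]. *)
rewrite [RHS]nth_default; last by rewrite szp leqNgt -mem_relabelling.
by rewrite nth_default // size_map memNindex.
Qed.

(** An injective map of the finite cube into itself is a bijection. *)
Lemma permute_cube : perm_eq (map (permute s) (cube n)) (cube n).
Proof.
have uniq_im : uniq (map (permute s) (cube n)).
  rewrite map_inj_in_uniq ?cube_uniq // => p q; rewrite !mem_cube => /eqP szp /eqP szq eq_pq.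
  apply: (@eq_from_nth _ false) => [|i _]; first by rewrite szp szq.
  by rewrite -nth_permute // eq_pq nth_permute.
apply: uniq_perm; rewrite ?cube_uniq //.
apply: (uniq_min_size uniq_im _ _).2; last by rewrite size_map.
by move=> _ /mapP[p _ ->]; rewrite mem_cube size_permute.
Qed.

Lemma below_permute p q : below p q -> below (permute s p) (permute s q).
Proof.
move=> pq; rewrite /permute; elim: s => //= k s' ->; rewrite andbT.
by apply/implyP/below_nth.
Qed.

Lemma negb_permute p : size p = n -> permute s (map negb p) = map negb (permute s p).
Proof.
move=> szp; rewrite -map_comp; apply/eq_in_map => i.
by rewrite mem_relabelling -szp => i_lt /=; rewrite (nth_map false).
Qed.

(** Relabelling [D] along with [F] preserves all counts; the star at [i] turns into the star at
    [index i s]. *)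
Lemma some_star_wins_permute (F : pred point_set) :
  some_star_wins n (fun p => F (permute s p)) -> some_star_wins n F.
Proof.
move=> win D D_down.
have [|i] := win (fun p => D (permute s p)).
  by move=> p q /below_permute; apply: D_down.
have relabel a : count a (cube n) = count (preim (permute s) a) (cube n).
  by rewrite -count_map (permP permute_cube).
move=> le_i; exists (index i s); rewrite relabel [X in _ <= X]relabel.
apply: leq_trans le_i _; rewrite leq_eqVlt; apply/orP; left; apply/eqP.
by apply: eq_in_count => p; rewrite mem_cube /= => /eqP szp; rewrite nth_permute.
Qed.

(** Up to the first known difference the two codes agree; there the relabelled family has the bit 1
    and [F] the bit 0, and that bit outweighs everything after it. *)
Lemma improvesP (t : trie (option bool) n) vs F :
  agrees t F -> all (fun v => size v == n) vs -> improves t s vs ->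
  code F vs < code (fun p => F (permute s p)) vs.
Proof.
move=> tF; elim: vs => //= v vs IH /andP[/eqP szv szvs].
case E1: (get t v) => [[]|//]; case E2: (get t _) => [[]|//] // imp;
  rewrite (tF _ _ szv E1) (tF _ _ (size_permute v) E2) ?ltn_add2l ?IH //.
have := code_lt F vs; lia.
Qed.

End Relabelling.

(** * Following one family through the search tree *)

Section Search.
Variables (n : nat) (all_vs : seq point_set) (F : pred point_set).
Hypotheses (F_up : up_closed F) (F_dual : self_dual n F).
Hypothesis all_vs_size : all (fun v => size v == n) all_vs.
Hypothesis code_max : forall F', up_closed F' -> self_dual n F' ->
  code F all_vs < code F' all_vs -> some_star_wins n F'.

Lemma agrees_decide (t : trie (option bool) n) v b :
  size v = n -> agrees t F -> F v = b -> agrees (decide t v b) F.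
Proof.
move=> szv tF Fv p c szp; rewrite /decide get_upd ?size_map //.
case: eqP => [-> [<-]|_]; first by rewrite F_dual // Fv.
by rewrite get_upd //; case: eqP => [-> [<-]|_ /tF->].
Qed.

(** The values of [F] single out a path in the tree, and a successful search has succeeded at every
    node on it. The path ends at a leaf, where [majorizedP] applies, or at a cut, where [code_max],
    the induction hypothesis for larger codes, applies to the relabelled family. *)
Lemma searchP vs (t : trie (option bool) n) members ss cs r :
  all (fun v => size v == n) vs -> agrees t F -> all F members ->
  search all_vs vs t members ss cs = Some r -> some_star_wins n F.
Proof.
have prune (t' : trie (option bool) n) ss' : agrees t' F ->
    (if ss' is s :: _ then improves t' s all_vs && perm_eq s (iota 0 n) else false) ->
    some_star_wins n F.
  case: ss' => // s ss' t'F /andP[imp s_perm].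
  apply: (some_star_wins_permute s_perm); apply: code_max.
  - by move=> p q /(below_permute s) pq; apply: F_up.
  - by move=> p szp; rewrite (negb_permute s_perm) // F_dual // (size_permute s_perm).
  - exact: improvesP t'F all_vs_size imp.
elim: vs t members ss cs r => [|v vs IH] t members ss cs r /= szvs tF Fm;
  case: ifP => [/(prune _ _ tF) //|_].
  by case: cs => // c cs; case: ifP => // /(majorizedP tF).
case/andP: szvs => /eqP szv szvs.
case Fv: (F v).
  (* A member disjoint from [v] lies below the complement of [v], which would then belong to [F]
     together with [v]. *)
  have -> : all (meets v) members.
    apply/allP => u /(allP Fm) Fu; apply/negP => /F_up /(_ Fu).
    by rewrite F_dual // Fv.
  case E1: (search _ _ _ _ _ _) => [[ss' cs']|//] _.
  by apply: IH E1; rewrite //= ?Fv //; apply: agrees_decide.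
case E1: (if _ then _ else _) => [[ss' cs']|//].
(* A member below [v] would force [v] into [F], so the branch excluding [v] has been explored. *)
have -> : has (below^~ v) members = false.
  by apply/negbTE/hasPn => u /(allP Fm) Fu; apply/negP => /F_up /(_ Fu); rewrite Fv.
by apply: IH => //; apply: agrees_decide.
Qed.

(** If the full set were missing, duality would put the empty set into [F], and upward closure the
    full set after all. *)
Lemma initial_trieP : agrees (initial_trie n) F.
Proof.
apply: agrees_decide; rewrite ?size_nseq //; first by move=> p b szp; rewrite get_tabulate.
apply/negPn/negP => Ffull; have := F_dual (size_nseq n true); rewrite Ffull => Fempty.
case/negP: Ffull; apply: F_up Fempty; rewrite map_nseq /=.
by elim: n => //= m ->.
Qed.

End Search.

Lemma undecided_size n : all (fun v => size v == n) (undecided_sets n).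
Proof.
by apply/allP => p; rewrite /undecided_sets !mem_cat !mem_filter !mem_cube;
  case/or3P => /andP[].
Qed.

(** * Extending an intersecting family to an up-closed, self-dual one *)

Section Extension.
Variables (n : nat) (G : seq point_set).
Hypothesis n_odd : odd n.
Hypothesis G_int : forall p q, p \in G -> q \in G -> meets p q.

Let small (p : point_set) := (count id p).*2 < n.
Let generated (p : point_set) := has (below^~ p) G.

(** Below half size, take the sets that contain a member of [G]; above, let duality dictate. This
    gives an explicit extension with no maximality argument. *)
Definition extension (p : point_set) :=
  if small p then generated p else ~~ generated (map negb p).

(** Members of [G] contained in two disjoint sets would themselves be disjoint. *)
Lemma generated_meet p q : generated p -> generated q -> below q (map negb p) -> False.
Proof.
case/hasP => u uG up /hasP[v vG vq] qp.
have := G_int uG vG; rewrite /meets => /negP; apply.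
by apply: below_trans vq _; apply: below_trans qp _; apply: below_negb.
Qed.

Lemma mem_extension p : p \in G -> extension p.
Proof.
move=> pG; have gen_p : generated p by apply/hasP; exists p => //; apply: below_refl.
rewrite /extension; case: ifP => // _; apply/negP => /(generated_meet gen_p); apply.
exact: below_refl.
Qed.

Lemma extension_up : up_closed extension.
Proof.
move=> p q pq; rewrite /extension.
have gen_up u v : below u v -> generated u -> generated v.
  by move=> uv /hasP[w wG wu]; apply/hasP; exists w => //; apply: below_trans uv.
case: ifP => sp; case: ifP => sq.
- exact: gen_up.
(* Here [p] is small and [q] large: [p] and the complement of [q] are disjoint, so they cannot both
   contain members of [G]. *)
- by move=> gp; apply/negP => /(generated_meet gp); apply; apply: below_negb.
- by move: sp sq (below_count pq); rewrite /small; lia.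
- by apply: contraNN; apply: gen_up; apply: below_negb.
Qed.

Lemma extension_dual : self_dual n extension.
Proof.
move=> p szp; rewrite /extension negb_setK.
(* As [n] is odd, exactly one of two complementary sets has fewer than half of the points. *)
have -> : small (map negb p) = ~~ small p.
  rewrite /small count_map; have := count_predC id p; rewrite szp.
  rewrite (@eq_count _ (preim negb id) (predC id)) //.
  by move: n_odd; lia.
by case: (small p); rewrite ?negbK.
Qed.

End Extension.

(** Induction on the distance of the code from its upper bound: a relabelling found at a cut
    strictly increases the code. *)
Lemma search_sound n ss cs :
  isSome (search (undecided_sets n) (undecided_sets n) (initial_trie n) [::] ss cs) ->
  forall F, up_closed F -> self_dual n F -> some_star_wins n F.
Proof.
case E: (search _ _ _ _ _ _) => [r|//] _ F.
have [m] := ubnP (2 ^ size (undecided_sets n) - code F (undecided_sets n)).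
elim: m F => // m IH F le_m F_up F_dual.
apply: (searchP F_up F_dual _ _ _ _ _ E) => //.
- exact: undecided_size.
- move=> F' F'_up F'_dual lt_code; apply: IH => //.
  by have := code_lt F' (undecided_sets n); lia.
- exact: undecided_size.
- exact: initial_trieP.
Qed.

(** The finite part of the proof: the whole tree for seven points is traversed by evaluation,
    checking every relabelling and shipping plan that it uses. *)
Lemma search_succeeds :
  isSome (search (undecided_sets 7) (undecided_sets 7) (initial_trie 7) [::]
            [seq (read_unary 7 0 c).1 | c <- relabellings] weightings).
Proof. by vm_compute. Qed.

(** * Families over an arbitrary finite type *)

Section Coding.
Variables (T : finType) (U : {set T}).
Hypothesis U_le7 : #|U| <= 7.

Let pos (x : T) := index x (enum U).

(** The length is 7 even when [U] is smaller; for subsets of [U] the spare positions hold [false]. A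
    point outside [U] gets position [#|U|], hence the restriction to subsets of [U] below. *)
Definition encode (A : {set T}) : point_set :=
  mkseq (fun i => [exists x in A, pos x == i]) 7.

Lemma pos_lt x : x \in U -> pos x < 7.
Proof. by move=> xU; apply: leq_trans U_le7; rewrite cardE index_mem mem_enum. Qed.

Lemma nth_encodeP (A : {set T}) i : A \subset U ->
  reflect (exists2 x, x \in A & pos x = i) (nth false (encode A) i).
Proof.
move=> AU; apply: (iffP idP) => [|[x xA <-]].
  have [lt_i|ge_i] := ltnP i 7; last by rewrite nth_default ?size_mkseq.
  by rewrite nth_mkseq // => /existsP[x /andP[xA /eqP <-]]; exists x.
rewrite nth_mkseq ?pos_lt ?(subsetP AU) //.
by apply/existsP; exists x; rewrite xA eqxx.
Qed.

Lemma nth_encode (A : {set T}) x : A \subset U -> x \in U ->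
  nth false (encode A) (pos x) = (x \in A).
Proof.
move=> AU xU; apply/nth_encodeP/idP => // [[y yA eq_pos]|]; last by exists x.
suff -> : x = y by [].
have yU := subsetP AU y yA.
by rewrite -(nth_index x (s := enum U) (x := x)) ?mem_enum // -/(pos x) -eq_pos nth_index ?mem_enum.
Qed.

Lemma encode_inj (A B : {set T}) :
  A \subset U -> B \subset U -> encode A = encode B -> A = B.
Proof.
move=> AU BU eqAB; apply/setP => x; have [xU|xU] := boolP (x \in U).
  by rewrite -(nth_encode AU xU) -(nth_encode BU xU) eqAB.
by rewrite (contraNF (subsetP AU x) xU) (contraNF (subsetP BU x) xU).
Qed.

(** This makes the encodings of a downset down-closed among Boolean vectors. *)
Lemma below_encode p (A : {set T}) : A \subset U -> below p (encode A) ->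
  exists2 B : {set T}, B \subset A & p = encode B.
Proof.
move=> AU pA; pose B := [set x in A | nth false p (pos x)].
have BA : B \subset A by apply/subsetP => x; rewrite inE => /andP[].
exists B => //; apply: (@eq_from_nth _ false) => [|i _].
  by rewrite (below_size pA) !size_mkseq.
have BU := subset_trans BA AU.
apply/idP/(nth_encodeP _ BU) => [p_i|[x]]; last by rewrite inE => /andP[_ ?] <-.
have /(nth_encodeP _ AU)[x xA pos_x] := below_nth pA p_i.
by exists x; rewrite // inE xA pos_x.
Qed.

Lemma encode_meets (A B : {set T}) : A \subset U -> B \subset U ->
  A :&: B != set0 -> meets (encode A) (encode B).
Proof.
move=> AU BU /set0Pn[x /setIP[xA xB]]; apply/negP => /below_nth.
have xU := subsetP AU x xA; move/(_ (pos x)); rewrite nth_encode // => /(_ xB).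
by rewrite (nth_map false) ?size_mkseq ?pos_lt // nth_encode // xA.
Qed.

Definition encodings (H : {set {set T}}) : seq point_set := map encode (enum H).

Lemma mem_encodings (H : {set {set T}}) p :
  reflect (exists2 A, A \in H & p = encode A) (p \in encodings H).
Proof.
apply: (iffP mapP) => -[A AH ->]; exists A => //; first by rewrite mem_enum in AH.
by rewrite mem_enum.
Qed.

Lemma count_encodings (H : {set {set T}}) : {in H, forall A : {set T}, A \subset U} ->
  count (mem (encodings H)) (cube 7) = #|H|.
Proof.
move=> HU; rewrite cardE -(size_map encode) -size_filter; apply: perm_size.
apply: uniq_perm; first exact/filter_uniq/cube_uniq.
  rewrite map_inj_in_uniq ?enum_uniq // => A B; rewrite !mem_enum => AH BH.
  by apply: encode_inj; apply: HU.
move=> p; rewrite mem_filter mem_cube andb_idr //.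
by case/mem_encodings => A _ ->; rewrite size_mkseq.
Qed.

(** The encoding of [G] extends to an up-closed, self-dual family [F]. Some star of [D] is at least
    as large as the part of [F] inside [D], and that part contains [G]. *)
Lemma intersecting_le_star (D G : {set {set T}}) :
  {in D, forall A : {set T}, A \subset U} -> downset D ->
  G \subset D -> intersecting G -> G != set0 ->
  exists2 x, x \in U & #|G| <= #|[set A in D | x \in A]|.
Proof.
move=> DU D_down /subsetP GD G_int /set0Pn[A0 A0G].
have GU : {in G, forall A : {set T}, A \subset U} by move=> A /GD/DU.
have codes_meet p q : p \in encodings G -> q \in encodings G -> meets p q.
  case/mem_encodings => A AG -> /mem_encodings[B BG ->].
  by apply: encode_meets; rewrite ?GU //; apply: G_int.
pose F := extension 7 (encodings G).
have /(_ (mem (encodings D)))[|i le_i] : some_star_wins 7 F.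
- by apply: (search_sound search_succeeds); [apply: extension_up | apply: extension_dual].
- move=> p q pq /mem_encodings[A AD eq_q]; rewrite eq_q in pq.
  have [B BA ->] := below_encode (DU A AD) pq.
  by apply/mem_encodings; exists B => //; apply: D_down BA.
have {le_i} le_i : #|G| <= count (fun p => nth false p i && (p \in encodings D)) (cube 7).
  rewrite -count_encodings //; apply: leq_trans le_i; apply: sub_count => p /= pG.
  rewrite /F mem_extension //=; case/mem_encodings: pG => A /GD AD ->.
  by apply/mem_encodings; exists A.
(* The winning position could be a spare one. As [G] is nonempty, so is the winning star, and any
   set in it shows that [i] is the position of a point of [U]. *)
have /hasP[p _ /andP[p_i /mem_encodings[A AD eq_p]]] :
    has (fun p => nth false p i && (p \in encodings D)) (cube 7).
  by rewrite has_count; apply: leq_trans le_i; apply/card_gt0P; exists A0.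
rewrite eq_p in p_i; have [x xA pos_x] := nth_encodeP i (DU A AD) p_i.
have xU := subsetP (DU A AD) x xA; exists x => //.
rewrite -[X in _ <= X]count_encodings; last by move=> B; rewrite inE => /andP[/DU].
apply: leq_trans le_i _; apply: sub_count => q /= /andP[q_i /mem_encodings[B BD eq_q]].
apply/mem_encodings; exists B; rewrite // inE BD /=.
by rewrite -nth_encode ?DU // pos_x -eq_q.
Qed.

End Coding.

(** * A largest star as a maximum intersecting family *)

Theorem theorem1p2 (T : finType) (D : {set {set T}})
  (D_downset : downset D)
  (U_nonempty : cover D != set0)
  (U_le7 : #|cover D| <= 7) :
  star_property D.
Proof.
have DU : {in D, forall A : {set T}, A \subset cover D} by move=> A; apply: bigcup_sup.
case/set0Pn: U_nonempty => x0 x0U.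
pose star_at x := [set A in D | x \in A].
(* The point [x] is chosen with the largest star, so the star that bounds a given intersecting
   family is itself bounded by the star at [x]. *)
case: (@arg_maxnP _ x0 (mem (cover D)) (fun x => #|star_at x|) x0U) => x xU x_max.
exists (star_at x); last first.
  exists x; last by move=> A; rewrite inE => /andP[].
  case/bigcupP: xU => A AD xA; apply/bigcupP; exists A => //.
  by rewrite inE AD.
split.
- by apply/subsetP => A; rewrite inE => /andP[].
- move=> A B; rewrite !inE => /andP[_ xA] /andP[_ xB].
  by apply/set0Pn; exists x; rewrite inE xA.
- move=> G GD G_int; have [->|G_nonempty] := eqVneq G set0; first by rewrite cards0.
  have [y yU le_y] := intersecting_le_star U_le7 DU D_downset GD G_int G_nonempty.
  exact: leq_trans le_y (x_max y yU).
Qed.
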